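(* Let $A$ be a unital (not necessarily associative) algebra over a field $F$ and let $R$ be a Rota--Baxter operator of weight $-1$ on $A$. Put $a=R(1)$. (a) If $\mathrm{char}\,F=0$ and $A$ is algebraic, then there exist integers $r,s\ge 0$ such that $H_{r,s}(a)=0$. (b) If $\mathrm{char}\,F=p>0$, then $H_{0,p}(a)=0$. In particular, under the conditions of (a) or of (b), the minimal polynomial of $a$ has no multiple roots.
   Context: An algebra over $F$ is an $F$-vector space with a bilinear product, not assumed associative or commutative; unital means having a two-sided identity $1$. A linear operator $R\colon A\to A$ is a Rota--Baxter operator of weight $\lambda\in F$ if $R(x)R(y)=R(R(x)y+xR(y)+\lambda xy)$ for all $x,y\in A$. An associative algebra is algebraic if each of its elements is a root of a nonzero polynomial over $F$; in the nonassociative case, an algebra is algebraic if every finite subset generates a finite-dimensional subalgebra. For integers $r,s\ge0$, $H_{r,s}(x)=(x-r)(x-r+1)\cdots(x-1)\,x(x+1)\cdots(x+s-1)=\prod_{i=-r}^{s-1}(x+i)$, a polynomial of degree $r+s$ ($H_{0,0}=1$). The subalgebra of $A$ generated by all $R^k(1)$, $k\ge0$, is commutative and associative, so polynomials in $a=R(1)$ are well defined. *)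

(* Defs.v *)
From HB Require Import structures.
From mathcomp Require Import all_boot all_order all_algebra.
Set Implicit Arguments.
Unset Strict Implicit.
Unset Printing Implicit Defensive.

Import GRing.Theory.
Local Open Scope ring_scope.

(* MathComp's algebra structures are all associative.  Here a unital algebra
   over F, not assumed associative, is a vector space A : lmodType F with a
   product mul : {bilinear A -> A -> A} and a two-sided identity one.  The
   zero algebra (one = 0) is allowed. *)

Section NonassociativeAlgebra.
Variables (F : fieldType) (A : lmodType F) (mul : A -> A -> A).

Definition rota_baxter (lambda : F) (R : A -> A) : Prop :=
  forall x y : A,
    mul (R x) (R y) = R (mul (R x) y + mul x (R y) + lambda *: mul x y).

Definition subalgebra (B : A -> Prop) : Prop :=
  [/\ B 0,
      forall (c : F) (x y : A), B x -> B y -> B (c *: x + y)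
    & forall x y : A, B x -> B y -> B (mul x y)].

(* Subalgebras need not contain the identity; adjoining it would raise the
   dimension by at most one. *)
Definition subalgebra_generated (S : seq A) (x : A) : Prop :=
  forall B : A -> Prop, subalgebra B -> {in S, forall y, B y} -> B x.

Definition finite_dimensional (B : A -> Prop) : Prop :=
  exists b : seq A, forall x : A,
    B x <-> exists c : 'I_(size b) -> F, x = \sum_(i < size b) c i *: b`_i.

Variable one : A.

(* Powers are bracketed as x * (x * (... * (x * 1))).  The bracketing is
   immaterial if the algebra is associative, or if x lies in an associative
   subalgebra, as does R 1 for a Rota-Baxter operator R. *)
Definition alg_exp (x : A) (n : nat) : A := iter n (mul x) one.

Definition poly_eval (p : {poly F}) (x : A) : A :=
  \sum_(i < size p) p`_i *: alg_exp x i.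

(* On associative algebras the second condition (local finiteness) would be
   stronger than the first. *)
Definition algebraic : Prop :=
     (associative mul
        /\ forall x : A, exists2 p : {poly F}, p != 0 & poly_eval p x = 0)
  \/ (~ associative mul
        /\ forall S : seq A, finite_dimensional (subalgebra_generated S)).

Definition minimal_polynomial (x : A) (m : {poly F}) : Prop :=
  [/\ m \is monic, poly_eval m x = 0
    & forall q : {poly F}, q != 0 -> poly_eval q x = 0 ->
        (size m <= size q)%N].

End NonassociativeAlgebra.

(* \prod_(i = -r)^(s-1) (X + i), reindexed by i = j - r. *)
Definition H_poly (F : fieldType) (r s : nat) : {poly F} :=
  \prod_(j < r + s) ('X + (j%:R - r%:R)%:P).

(* Roots are taken in arbitrary extension fields of F. *)
Definition no_multiple_roots (F : fieldType) (m : {poly F}) : Prop :=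
  forall (L : fieldType) (iota : {rmorphism F -> L}) (x : L),
    (mup x (map_poly iota m) <= 1)%N.

(* Main.v *)
Require Import Defs.
From mathcomp Require Import all_boot all_order all_algebra.
From mathcomp Require Import separable ring.
From Stdlib Require Import Classical_Prop.
Set Implicit Arguments.
Unset Strict Implicit.
Unset Printing Implicit Defensive.

Import GRing.Theory.
Local Open Scope ring_scope.

(** For weight -1 the Rota-Baxter identity gives [n! R^n(1) = H_{0,n}(a)];
    in characteristic p the case n = p is (b).  In characteristic 0 it says
    that R acts on polynomials in a as the summation operator
    [S f (x) = f(1) + ... + f(x)], so [f(a) = 0] implies [(S f)(a) = 0].  If m
    is the minimal polynomial of a, of degree n, then m divides S m, i.e.
    [S m = q m] with q of degree 1 and leading coefficient 1/(n+1).
    Writing [q = (x + e) / (n+1)], the equation [S m (x) - S m (x-1) = m(x)]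
    becomes [m(x) (x + e - n - 1) = m(x-1) (x - 1 + e)], which forces the roots
    1-e, ..., n-e of m, and [S m (0) = 0] forces e to be one of 0, ..., n. *)

(** * Roots of [H_poly], and a difference equation that forces them *)

Section PolynomialsH.
Variable F : fieldType.

Lemma H_poly_XsubC (r s : nat) :
  H_poly F r s =
    \prod_(c <- [seq r%:R - j%:R | j : 'I_(r + s)]) ('X - c%:P).
Proof.
rewrite big_image /H_poly; apply: eq_bigr => j _.
by rewrite -[_ - r%:R]opprB polyCN.
Qed.

Lemma size_H_poly (r s : nat) : size (H_poly F r s) = (r + s).+1.
Proof. by rewrite H_poly_XsubC size_prod_XsubC size_map -cardE card_ord. Qed.

Lemma monic_H_poly (r s : nat) : H_poly F r s \is monic.
Proof. by rewrite H_poly_XsubC monic_prod_XsubC. Qed.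

(** Injectivity is asked only below [r + s], which covers characteristic 0 as well as [r = 0],
    [s = p] in characteristic p. *)
Lemma uniq_roots_H_poly (r s : nat) :
  {in gtn (r + s) &, injective (fun j => j%:R : F)} ->
  uniq [seq (r%:R - j%:R : F) | j : 'I_(r + s)].
Proof.
move=> inj; rewrite map_inj_in_uniq ?enum_uniq // => i j _ _ /addrI/oppr_inj.
by move/(inj _ _ (ltn_ord i) (ltn_ord j)); apply: val_inj.
Qed.

Lemma separable_H_poly (r s : nat) :
  {in gtn (r + s) &, injective (fun j => j%:R : F)} ->
  separable_poly (H_poly F r s).
Proof.
by move=> inj; rewrite H_poly_XsubC separable_prod_XsubC uniq_roots_H_poly.
Qed.

Lemma H_poly0S (n : nat) :
  H_poly F 0 n.+1 = H_poly F 0 n * ('X + n%:R%:P).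
Proof. by rewrite /H_poly big_ord_recr /= subr0. Qed.

(** The shift of x(x+1)...(x+n) by -1 loses the last factor and gains x-1. With [H_poly0S], the
    backward difference of H_{0,n+1} is therefore (n+1) H_{0,n}. *)
Lemma horner_H_poly0_pred (n : nat) (x : F) :
  (H_poly F 0 n.+1).[x - 1] = (x - 1) * (H_poly F 0 n).[x].
Proof.
elim: n => [|n IHn].
  by rewrite H_poly0S /H_poly big_ord0 mul1r !hornerE.
by rewrite H_poly0S hornerM IHn H_poly0S !hornerE -[n.+1%:R]natr1 /=; ring.
Qed.

Lemma natr_inj_pchar0 :
  [pchar F] =i pred0 -> injective (fun n => n%:R : F).
Proof.
move=> /pcharf0P char0.
have le_inj i j : (i <= j)%N -> i%:R = j%:R :> F -> i = j.
  move=> le_ij eq_ij; apply/eqP; rewrite eqn_leq le_ij /= -subn_eq0.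
  by rewrite -char0 natrB // eq_ij subrr.
move=> i j eq_ij; have [/le_inj|/ltnW/le_inj] := leqP i j; first exact.
by move=> <-.
Qed.

Lemma natr_inj_pchar (p : nat) :
  p \in [pchar F] -> {in gtn p &, injective (fun n => n%:R : F)}.
Proof.
move=> charp.
have le_inj i j : (i <= j < p)%N -> i%:R = j%:R :> F -> i = j.
  move=> /andP[le_ij lt_jp] eq_ij; apply/eqP.
  rewrite eqn_leq le_ij /= -subn_eq0.
  have : (p %| j - i)%N by rewrite (dvdn_pcharf charp) natrB // eq_ij subrr.
  apply: contraLR; rewrite -lt0n => ji_gt0; rewrite gtnNdvd //.
  exact: leq_ltn_trans (leq_subr _ _) lt_jp.
move=> i j; rewrite !inE => lt_ip lt_jp eq_ij.
have [le_ij|/ltnW le_ji] := leqP i j; first by apply: le_inj; rewrite ?le_ij.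
by apply/esym/le_inj; rewrite ?le_ji.
Qed.

(** Separability survives field extension and excludes the square of a linear factor. *)
Lemma separable_no_multiple_roots (m : {poly F}) :
  separable_poly m -> no_multiple_roots m.
Proof.
move=> sep_m L iota x; rewrite leqNgt mup_geq; last first.
  by rewrite map_poly_eq0 separable_poly_neq0.
by rewrite separable_nosquare ?separable_map // size_XsubC.
Qed.

Lemma H_poly_of_sum_multiple (m q : {poly F}) :
  [pchar F] =i pred0 -> m \is monic -> size q = 2 ->
  (size m)%:R * lead_coef q = 1 -> (q * m).[0] = 0 ->
  (forall x, (q * m).[x] - (q * m).[x - 1] = m.[x]) ->
  exists r s : nat, m = H_poly F r s.
Proof.
move=> char0 monm szq lcq qm0 eqm.
have natr_inj := natr_inj_pchar0 char0.
have natr_neq0 k : k.+1%:R != 0 :> F by move/pcharf0P: (char0) => ->.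
have [n szm] : exists n, size m = n.+1.
  by exists (size m).-1; rewrite prednK // size_poly_gt0 monic_neq0.
(* Since [q] has leading coefficient 1/(n+1), this makes (n+1) q = X + e. *)
pose e := n.+1%:R * q`_0.
have qE x : n.+1%:R * q.[x] = x + e.
  rewrite horner_coef szq !big_ord_recl big_ord0 /= expr0 expr1 addr0 mulr1.
  move: lcq; rewrite /lead_coef szq szm /= mulrDr mulrA => ->.
  by rewrite mul1r addrC.
have meq x : m.[x] * (x + e - n.+1%:R) = m.[x - 1] * (x - 1 + e).
  rewrite -!qE (_ : _ * _ = n.+1%:R * ((q * m).[x] - m.[x])).
    by rewrite -[m.[x]]eqm subKr hornerM; ring.
  by rewrite hornerM; ring.
(* Put x = k+1-e in [meq]: the right side vanishes, through x-1+e if k = 0 and by induction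
   otherwise, while x+e-(n+1) = k-n is nonzero. *)
have root_m k : (k < n)%N -> m.[k.+1%:R - e] = 0.
  elim: k => [n_gt0|k IHk lt_kn].
    have /eqP := meq (1 - e).
    rewrite (_ : 1 - e - 1 + e = 0) ?mulr0; last by ring.
    rewrite mulf_eq0 => /orP[/eqP //|].
    rewrite subrK -[n.+1%:R]natr1 opprD addrC subrK oppr_eq0.
    by rewrite -(prednK n_gt0) (negPf (natr_neq0 _)).
  have /eqP := meq (k.+2%:R - e).
  rewrite (_ : k.+2%:R - e - 1 = k.+1%:R - e); last by rewrite -natr1; ring.
  rewrite IHk 1?ltnW // mul0r mulf_eq0 => /orP[/eqP //|].
  rewrite subrK subr_eq0 => /eqP/natr_inj [] eq_kn.
  by rewrite -eq_kn ltnn in lt_kn.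
have mP (r s : nat) : n = (r + s)%N -> e = s%:R -> m = H_poly F r s.
  move=> n_rs e_s.
  rewrite H_poly_XsubC -[RHS]scale1r -[X in X *: _](monicP monm).
  apply: all_roots_prod_XsubC.
  - by rewrite szm size_map -cardE card_ord n_rs.
  - apply/allP=> _ /imageP[j _ ->]; rewrite /root.
    have lt_jn : (j < n)%N by rewrite n_rs.
    (* The root r-j of H_{r,s} equals (n-j)-e. *)
    have := root_m (n - j.+1)%N.
    rewrite subnSK // natrB ?(ltnW lt_jn) // e_s {3}n_rs natrD.
    rewrite (_ : _ - s%:R = r%:R - j%:R); last by ring.
    by move=> ->; rewrite ?leq_subr.
  - rewrite uniq_rootsE uniq_roots_H_poly // => i j _ _; exact: natr_inj.
suff [s le_sn e_s] : exists2 s, (s <= n)%N & e = s%:R.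
  by exists (n - s)%N, s; apply: mP; rewrite ?subnK.
(* As (n+1) q(0) = e, either e = 0 or 0 is a root of [m]. The n distinct values i+1-e exhaust the
   roots of [m], so in the second case e = i+1 for some i < n. *)
have /eqP : e * m.[0] = 0 by rewrite -[e]add0r -qE -mulrA -hornerM qm0 mulr0.
rewrite mulf_eq0 => /orP[/eqP->|m0]; first by exists 0%N.
pose rs := [seq i.+1%:R - e | i : 'I_n].
have mE : m = lead_coef m *: \prod_(z <- rs) ('X - z%:P).
  apply: all_roots_prod_XsubC.
  - by rewrite szm size_map -cardE card_ord.
  - by apply/allP=> _ /imageP[j _ ->]; rewrite /root root_m.
  - rewrite uniq_rootsE map_inj_uniq ?enum_uniq // => i j.
    by move/addIr/natr_inj=> [] /val_inj.
move: m0; rewrite -/(root m 0) mE (monicP monm) scale1r root_prod_XsubC.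
case/imageP=> i _ /esym/eqP; rewrite subr_eq0 => /eqP e_i.
by exists i.+1.
Qed.

End PolynomialsH.

(** * Evaluation at an element, annihilators and minimal polynomials *)

Section PolynomialEvaluation.
Variables (F : fieldType) (A : lmodType F).
Variables (mul : {bilinear A -> A -> A}) (one : A) (x : A).

Lemma poly_eval_wide (p : {poly F}) (n : nat) : (size p <= n)%N ->
  poly_eval mul one p x = \sum_(i < n) p`_i *: alg_exp mul one x i.
Proof.
move=> le_pn; rewrite /poly_eval.
rewrite (big_ord_widen n (fun i => p`_i *: alg_exp mul one x i)) //.
rewrite big_mkcond; apply: eq_bigr => i _.
by case: ltnP => // le_pi; rewrite nth_default ?scale0r.
Qed.

Lemma poly_eval_is_linear : linear (fun p => poly_eval mul one p x).
Proof.
move=> c p q; set n := maxn (size p) (size q).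
have le_pn : (size p <= n)%N by rewrite leq_maxl.
have le_qn : (size q <= n)%N by rewrite leq_maxr.
have le_pqn : (size (c *: p + q)%R <= n)%N.
  rewrite (leq_trans (size_polyD _ _)) // geq_max le_qn andbT.
  exact: leq_trans (size_scale_leq _ _) le_pn.
rewrite !(@poly_eval_wide _ n) // scaler_sumr -big_split /=.
by apply: eq_bigr => i _; rewrite coefD coefZ scalerDl scalerA.
Qed.

Lemma poly_evalD (p q : {poly F}) :
  poly_eval mul one (p + q) x = poly_eval mul one p x + poly_eval mul one q x.
Proof. by have := poly_eval_is_linear 1 p q; rewrite !scale1r. Qed.

Lemma poly_eval0 : poly_eval mul one 0 x = 0.
Proof. by rewrite /poly_eval size_poly0 big_ord0. Qed.

Lemma poly_evalZ (c : F) (p : {poly F}) :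
  poly_eval mul one (c *: p) x = c *: poly_eval mul one p x.
Proof.
by have := poly_eval_is_linear c p 0; rewrite !addr0 poly_eval0 addr0.
Qed.

Lemma poly_eval1 : poly_eval mul one 1 x = one.
Proof. by rewrite /poly_eval size_poly1 big_ord1 coefC /= scale1r. Qed.

Lemma poly_evalMX (p : {poly F}) :
  poly_eval mul one (p * 'X) x = mul x (poly_eval mul one p x).
Proof.
rewrite (@poly_eval_wide _ (size p).+1); last first.
  by rewrite (leq_trans (size_polyMleq _ _)) // size_polyX addn2.
rewrite big_ord_recl coefMX /= scale0r add0r /poly_eval linear_sumr.
by apply: eq_bigr => i _; rewrite coefMX /= linearZr_LR.
Qed.

(** Without associativity, Horner's scheme still shows that evaluating [p * q] applies p(L) to the
    value of [q], where L is left multiplication by [x]. *)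
Lemma poly_evalM_eq0 (p q : {poly F}) :
  poly_eval mul one q x = 0 -> poly_eval mul one (p * q) x = 0.
Proof.
move=> q0; elim/poly_ind: p => [|p c IHp]; first by rewrite mul0r poly_eval0.
rewrite mulrDl mulrAC poly_evalD poly_evalMX IHp linear0r add0r.
by rewrite mul_polyC poly_evalZ q0 scaler0.
Qed.

(** Descent on the size: excluded middle decides whether a smaller annihilator exists. *)
Lemma minimal_polynomial_exists (p : {poly F}) :
  p != 0 -> poly_eval mul one p x = 0 ->
  exists m, minimal_polynomial mul one x m.
Proof.
elim: (size p) {-2}p (leqnn (size p)) => {p} [|n IHn] p.
  by rewrite leqn0 size_poly_eq0 => /eqP->; rewrite eqxx.
move=> le_pn p_neq0 p0.
have [[q [q_neq0 q0 lt_qp]]|min_p] := classic (exists q : {poly F},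
    [/\ q != 0, poly_eval mul one q x = 0 & (size q < size p)%N]).
  by apply: (IHn q) => //; rewrite -ltnS (leq_trans lt_qp).
exists ((lead_coef p)^-1 *: p); split.
- by rewrite monicE lead_coefZ mulVf // lead_coef_eq0.
- by rewrite poly_evalZ p0 scaler0.
move=> q q_neq0 q0; rewrite size_scale ?invr_eq0 ?lead_coef_eq0 // leqNgt.
by apply/negP=> lt_qp; apply: min_p; exists q.
Qed.

Lemma minimal_polynomial_dvdp (m p : {poly F}) :
  minimal_polynomial mul one x m -> poly_eval mul one p x = 0 -> m %| p.
Proof.
move=> [monm m0 min_m] p0; rewrite /dvdp; apply: contraT => pm_neq0.
have := min_m _ pm_neq0; rewrite leqNgt ltn_modp monic_neq0 //; apply.
have := poly_evalD (p %/ m * m) (p %% m).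
by rewrite -divp_eq p0 poly_evalM_eq0 // add0r.
Qed.

(** In the nonassociative case all positive powers of [x] lie in the span of [b], so the first
    [(size b).+1] of them are linearly dependent. *)
Lemma algebraic_annihilator :
  right_id one mul -> algebraic mul one ->
  exists2 p : {poly F}, p != 0 & poly_eval mul one p x = 0.
Proof.
move=> mulx1 [[_ /(_ x)] //|[_ /(_ [:: x])[b genE]]].
have gen_exp i : subalgebra_generated mul [:: x] (alg_exp mul one x i.+1).
  move=> B [_ _ BM] Bx; have {}Bx : B x by apply: Bx; rewrite inE.
  elim: i => [|i IHi]; first by rewrite /alg_exp /= mulx1.
  exact: BM.
have /fin_all_exists[C CE] (i : 'I_(size b).+1) : exists c : 'I_(size b) -> F,
    alg_exp mul one x i.+1 = \sum_(j < size b) c j *: b`_j.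
  exact: (proj1 (genE _) (gen_exp i)).
pose M : 'M_((size b).+1, size b) := \matrix_(i, j) C i j.
have /rowV0Pn[v /sub_kermxP vM0 v_neq0] : kermx M != 0.
  by rewrite kermx_eq0 /row_free neq_ltn ltnS rank_leq_col.
pose p := \poly_(i < (size b).+1) v 0 (inord i).
(* The generated subalgebra may miss [one], so the dependence starts at the first power; hence the
   factor ['X]. *)
exists (p * 'X).
  rewrite mulf_neq0 ?polyX_eq0 //; apply: contraNneq v_neq0 => p0.
  apply/eqP/rowP=> i; have := congr1 (fun q : {poly F} => q`_i) p0.
  by rewrite coef_poly ltn_ord inord_val coef0 mxE.
rewrite poly_evalMX (poly_eval_wide (size_poly _ _)) linear_sumr.
transitivity (\sum_(j < size b) (v *m M) 0 j *: b`_j); last first.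
  by rewrite vM0 big1 // => j _; rewrite mxE scale0r.
under [RHS]eq_bigr => j _ do rewrite mxE scaler_suml.
rewrite exchange_big /=; apply: eq_bigr => i _.
rewrite linearZr_LR coef_poly ltn_ord inord_val.
rewrite -[mul x _]/(alg_exp mul one x i.+1) CE scaler_sumr.
by apply: eq_bigr => j _; rewrite mxE scalerA.
Qed.

End PolynomialEvaluation.

(** * Action of [R] on polynomials in [R one] *)

Section RotaBaxterUnit.
Variables (F : fieldType) (A : lmodType F).
Variables (mul : {bilinear A -> A -> A}) (one : A).
Hypotheses (mul1x : left_id one mul) (mulx1 : right_id one mul).
Variable R : {linear A -> A}.
Hypothesis RB : rota_baxter mul (-1) R.

Local Notation a := (R one).
Local Notation eval p := (poly_eval mul one p a).

(** For y = R^n(1), the Rota-Baxter identity at 1 and y reads a R(y) = R(a y + R(y) - y). Adding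
    (n+1) R(y) turns the argument into a y + n y + R(y), where induction applies. *)
Lemma mul_R1_iter (n : nat) :
  mul a (iter n R one) + n%:R *: iter n R one = n.+1%:R *: iter n.+1 R one.
Proof.
elim: n => [|n IHn]; first by rewrite /= mulx1 scale0r addr0 scale1r.
pose y := iter n R one; rewrite -/y in IHn.
rewrite [iter n.+2 R one]/= -[iter n.+1 R one]/(R y) in IHn *.
rewrite RB !mul1x scaleN1r -[X in _ + X]linearZ -linearZ -linearD; congr (R _).
rewrite -natr1 scalerDl scale1r [_ *: y + y]addrC addrA subrK addrAC IHn.
by rewrite -[in RHS]natr1 scalerDl scale1r.
Qed.

(** The new factor X + n acts on R^n(1) as in [mul_R1_iter]. *)
Lemma poly_eval_H_poly0 (n : nat) :
  eval (H_poly F 0 n) = n`!%:R *: iter n R one.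
Proof.
elim: n => [|n IHn].
  by rewrite /H_poly big_ord0 poly_eval1 scale1r.
rewrite H_poly0S mulrDr poly_evalD poly_evalMX [_ * _%:P]mulrC mul_polyC.
rewrite poly_evalZ IHn linearZr_LR scalerA mulrC -scalerA -scalerDr.
by rewrite mul_R1_iter scalerA -natrM mulnC -factS.
Qed.

(** Here [g] is the sum S f, built on the basis of the H_{0,k}: S sends H_{0,k} to H_{0,k+1}/(k+1),
    and [R] does the same to their values at a, because H_{0,k}(a) = k! R^k(1). *)
Lemma R_poly_eval_sum (n : nat) (f : {poly F}) :
  [pchar F] =i pred0 -> (size f <= n)%N ->
  exists g : {poly F},
    [/\ (size g <= n.+1)%N, n%:R * g`_n = f`_n.-1, g.[0] = 0,
        forall x, g.[x] - g.[x - 1] = f.[x]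
      & eval g = R (eval f)].
Proof.
move=> /pcharf0P char0; elim: n f => [|n IHn] f le_fn.
  (* For n = 0 the index [n.-1] is 0 again, harmless since [f] vanishes. *)
  have -> : f = 0 by apply/eqP; rewrite -size_poly_eq0 -leqn0.
  exists 0; split; rewrite ?size_poly0 ?coef0 ?mul0r ?horner0 //.
    by move=> x; rewrite !horner0 subrr.
  by rewrite poly_eval0 linear0.
have n1_neq0 : n.+1%:R != 0 :> F by rewrite char0.
have H_lead k : (H_poly F 0 k)`_k = 1.
  by have /monicP := monic_H_poly F 0 k; rewrite /lead_coef size_H_poly.
(* H_{0,n} is monic of degree n, so the subtraction removes the top coefficient of [f]. *)
pose c := f`_n; pose f' := f - c *: H_poly F 0 n.
have [|g [le_gn _ g0 gE g_eval]] := IHn f'.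
  apply/leq_sizeP=> j; rewrite leq_eqVlt coefB coefZ => /predU1P[<-|lt_nj].
    by rewrite H_lead mulr1 subrr.
  rewrite !nth_default ?mulr0 ?subr0 ?size_H_poly //.
  exact: leq_trans le_fn lt_nj.
pose d := c / n.+1%:R; exists (g + d *: H_poly F 0 n.+1); split.
- rewrite (leq_trans (size_polyD _ _)) // geq_max (leq_trans le_gn) //=.
  by rewrite (leq_trans (size_scale_leq _ _)) // size_H_poly.
- by rewrite coefD coefZ H_lead nth_default // add0r mulr1 mulrC divfK.
- rewrite hornerD g0 hornerZ add0r /H_poly big_ord_recl hornerM.
  by rewrite subrr addr0 hornerX mul0r mulr0.
- move=> x; rewrite !hornerE horner_H_poly0_pred H_poly0S !hornerE.
  have -> : f.[x] = g.[x] - g.[x - 1] + c * (H_poly F 0 n).[x].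
    by rewrite gE !hornerE subrK.
  have -> : c = d * (n%:R + 1) by rewrite natr1 divfK.
  by rewrite /=; ring.
rewrite poly_evalD g_eval poly_evalZ poly_eval_H_poly0.
have -> : eval f = eval f' + c *: eval (H_poly F 0 n).
  by rewrite -poly_evalZ -poly_evalD subrK.
rewrite poly_eval_H_poly0 linearD 2![in RHS]linearZZ !scalerA factS natrM mulrA.
by rewrite divfK.
Qed.

Lemma minimal_polynomial_R1_H_poly (m : {poly F}) :
  [pchar F] =i pred0 -> minimal_polynomial mul one a m ->
  exists r s : nat, m = H_poly F r s.
Proof.
move=> char0 min_m; have [monm m0 _] := min_m.
have m_neq0 := monic_neq0 monm.
have [g [le_g lead_g g0 gE g_eval]] := R_poly_eval_sum char0 (leqnn (size m)).
have /(minimal_polynomial_dvdp min_m)/dvdpP[q g_qm] : eval g = 0.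
  by rewrite g_eval m0 linear0.
(* The top coefficient of [g] times [size m] is now 1, so deg g = deg m + 1 and the quotient [q] is
   linear. *)
rewrite -[m`__]/(lead_coef m) (monicP monm) in lead_g.
have gn_neq0 : g`_(size m) != 0.
  by apply: contra_eq_neq lead_g => ->; rewrite mulr0 eq_sym oner_eq0.
have szg : size g = (size m).+1.
  apply/anti_leq; rewrite le_g /= ltnNge.
  by apply: contra gn_neq0 => /leq_sizeP->.
have q_neq0 : q != 0.
  by apply: contra_eq_neq szg => q0; rewrite g_qm q0 mul0r size_poly0.
have szq : size q = 2.
  move: szg; rewrite g_qm size_mul // -(prednK (n := size m)) ?size_poly_gt0 //.
  by rewrite addnS /= -[in RHS]addn2 addnC => /addnI.
apply: (@H_poly_of_sum_multiple F m q); rewrite // -?g_qm //.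
by rewrite -[lead_coef q](lead_coef_Mmonic q monm) -g_qm /lead_coef szg.
Qed.

End RotaBaxterUnit.

Theorem theorem3 (F : fieldType) (A : lmodType F)
  (mul : {bilinear A -> A -> A}) (one : A)
  (mul1x : left_id one mul) (mulx1 : right_id one mul)
  (R : {linear A -> A}) (RB : rota_baxter mul (-1) R) :
  let a := R one in
  let hyp_a := [pchar F] =i pred0 /\ algebraic mul one in
  let hyp_b := exists p : nat, p \in [pchar F] in
  [/\ hyp_a -> exists r s : nat, poly_eval mul one (H_poly F r s) a = 0,
      forall p : nat, p \in [pchar F] ->
        poly_eval mul one (H_poly F 0 p) a = 0
    & hyp_a \/ hyp_b ->
        (exists m : {poly F}, minimal_polynomial mul one a m)
        /\ forall m : {poly F}, minimal_polynomial mul one a m ->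
             no_multiple_roots m].
Proof.
move=> a hyp_a hyp_b.
have min_a : hyp_a -> exists m, minimal_polynomial mul one a m.
  move=> [_ /(algebraic_annihilator a mulx1)[p]].
  exact: minimal_polynomial_exists.
have H_min_a : hyp_a -> forall m, minimal_polynomial mul one a m ->
    exists r s : nat, m = H_poly F r s.
  by move=> [char0 _] m; apply: minimal_polynomial_R1_H_poly.
have H_b p : p \in [pchar F] -> poly_eval mul one (H_poly F 0 p) a = 0.
  move=> charp; rewrite poly_eval_H_poly0 //.
  have /eqP-> : p`!%:R == 0 :> F.
    by rewrite -(dvdn_pcharf charp) dvdn_fact // leqnn
      prime_gt0 // (pcharf_prime charp).
  by rewrite scale0r.
split=> //.
  move=> ha; have [m min_m] := min_a ha.
  have [r [s m_rs]] := H_min_a ha m min_m; exists r, s; rewrite -m_rs.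
  by have [] := min_m.
move=> [ha|[p charp]].
  split=> [|m /(H_min_a ha)[r [s ->]]]; first exact: min_a.
  apply/separable_no_multiple_roots/separable_H_poly => i j _ _.
  by apply: natr_inj_pchar0; have [] := ha.
split=> [|m /minimal_polynomial_dvdp/(_ (H_b p charp)) m_dvd].
  apply: minimal_polynomial_exists (H_b p charp).
  exact/monic_neq0/monic_H_poly.
(* In characteristic p, [m] divides H_{0,p}, whose roots 0, -1, ..., -(p-1) are distinct. *)
apply/separable_no_multiple_roots/(dvdp_separable m_dvd)/separable_H_poly.
exact: natr_inj_pchar charp.
Qed.
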